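(* For every ordinal $\alpha$ the $(\alpha+1)$-bicyclic monoid $\mathcal{B}_{\alpha+1}$ is isomorphic (as a semigroup) to the Bruck extension $B(\mathcal{B}_{\alpha})$ of the $\alpha$-bicyclic monoid $\mathcal{B}_{\alpha}$.
   Context: Ordinals are von Neumann ordinals (so $\omega^{\alpha}$ is identified with the set of ordinals less than $\omega^{\alpha}$, ordinal exponentiation), $+$ is ordinal addition, and $\omega=\{0,1,2,\dots\}$. For ordinals $a\ge b$, $a-b$ denotes the unique ordinal $c$ with $a=b+c$. For an ordinal $\alpha$, the $\alpha$-bicyclic monoid $\mathcal{B}_{\alpha}$ is the set $\omega^{\alpha}\times\omega^{\alpha}$ of pairs of ordinals less than $\omega^\alpha$, with the operation $(a,b)\cdot(c,d)=(a+(c-b),d)$ if $b\le c$, and $(a,b)\cdot(c,d)=(a,d+(b-c))$ if $b>c$. For a semigroup $(S,\star)$, the Bruck extension $B(S)$ is the set $\omega\times S\times\omega$ with the operation $(a,s,b)\cdot(c,t,d)=(a+c-b,t,d)$ if $b<c$; $=(a,s,d+b-c)$ if $b>c$; $=(a,s\star t,d)$ if $b=c$. *)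

(* Defs.v *)
From HB Require Import structures.
From mathcomp Require Import all_boot all_order.
From mathcomp Require Import boolp classical_sets.
From mathcomp Require Import zify.

Set Implicit Arguments.
Unset Strict Implicit.
Unset Printing Implicit Defensive.

Import Order.TTheory.

Local Open Scope order_scope.
Local Open Scope quotient_scope.

(** [Sup f] is a code for the least ordinal strictly above every [f i], i.e.
    for the von Neumann ordinal whose elements are the ordinals <= some [f i].
    Ordinals are such codes up to having the same elements; the indexing types
    range over a fixed universe, [Ord] itself living in the next one. *)
Inductive tree : Type := Sup (I : Type) of (I -> tree).

HB.instance Definition _ := gen_eqMixin tree.
HB.instance Definition _ := gen_choiceMixin tree.

Definition branch (t : tree) : Type := let: Sup A _ := t in A.
Definition subtree (t : tree) : branch t -> tree :=
  let: Sup A f as t := t return branch t -> tree in f.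

(** [Sup f <= u] iff every [f i < u], i.e. every [f i] is [<=] some [g j]. *)
Fixpoint le_tree (t u : tree) : Prop :=
  let: Sup A f := t in let: Sup B g := u in
  forall i, exists j, le_tree (f i) (g j).

Lemma le_treeE t u : le_tree t u <->
  forall i : branch t, exists j : branch u, le_tree (subtree i) (subtree j).
Proof. by case: t => A f; case: u. Qed.

Lemma le_tree_refl t : le_tree t t.
Proof. by elim: t => A f IH /= i; exists i. Qed.

Lemma le_tree_trans u t v : le_tree t u -> le_tree u v -> le_tree t v.
Proof.
elim: t u v => A f IH [J g] [K h] /= tu uv i.
by have [j /IH fg] := tu i; have [k /fg] := uv j; exists k.
Qed.

Lemma subtree_le t (i : branch t) : le_tree (subtree i) t.
Proof.
elim: t i => A f IH i; apply/le_treeE => /= j; exists i; exact: IH.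
Qed.

Lemma le_tree_total t u :
  le_tree t u \/ exists i : branch t, le_tree u (subtree i).
Proof.
elim: t u => A f IH [J g].
have [tu|/existsNP[i fi]] :=
  pselect (forall i, exists j, le_tree (f i) (g j)); first by left.
right; exists i; apply/le_treeE => j /=.
by have [fg|//] := IH i (g j); case: fi; exists j.
Qed.

Definition tree_eq (t u : tree) : bool := `[< le_tree t u /\ le_tree u t >].

Lemma tree_eq_refl : reflexive tree_eq.
Proof. by move=> t; apply/asboolP; split; exact: le_tree_refl. Qed.

Lemma tree_eq_sym : symmetric tree_eq.
Proof. by move=> t u; apply/asboolP/asboolP => -[]. Qed.

Lemma tree_eq_trans : transitive tree_eq.
Proof.
move=> u t v /asboolP[tu ut] /asboolP[uv vu].
by apply/asboolP; split; exact: (le_tree_trans (u := u)).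
Qed.

Canonical tree_equiv := EquivRel tree_eq tree_eq_refl tree_eq_sym tree_eq_trans.

Definition Ord : Type := {eq_quot tree_equiv}.
HB.instance Definition _ := Choice.on Ord.
HB.instance Definition _ := EqQuotient.on Ord.

Definition le_ord (x y : Ord) : bool := `[< le_tree (repr x) (repr y) >].

Lemma le_ord_pi t u : reflect (le_tree t u) (le_ord (\pi_Ord t) (\pi u)).
Proof.
have repr_pi v : le_tree (repr (\pi_Ord v)) v /\ le_tree v (repr (\pi_Ord v)).
  by apply/asboolP; rewrite -[asbool _]/(tree_equiv _ _) -eqmodE reprK.
have [t1 t2] := repr_pi t; have [u1 u2] := repr_pi u.
apply: (iffP (asboolP _)) => H.
  exact: le_tree_trans (le_tree_trans t2 H) u1.
exact: le_tree_trans (le_tree_trans t1 H) u2.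
Qed.

Lemma le_ord_refl : reflexive le_ord.
Proof. by move=> x; apply/asboolP/le_tree_refl. Qed.

Lemma le_ord_anti : antisymmetric le_ord.
Proof.
move=> x y /andP[/asboolP xy /asboolP yx]; rewrite -[x]reprK -[y]reprK.
by apply/eqmodP/asboolP.
Qed.

Lemma le_ord_trans : transitive le_ord.
Proof.
by move=> y x z /asboolP xy /asboolP yz; apply/asboolP/(le_tree_trans xy).
Qed.

Lemma le_ord_total : total le_ord.
Proof.
move=> x y; apply/orP; have [xy|[i yi]] := le_tree_total (repr x) (repr y).
  by left; apply/asboolP.
by right; apply/asboolP/(le_tree_trans yi)/subtree_le.
Qed.

Fact ord_display : Order.disp_t. Proof. exact: Order.Disp tt tt. Qed.

HB.instance Definition _ := Order.Le_isPOrder.Build ord_display Ord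
  le_ord_refl le_ord_anti le_ord_trans.
HB.instance Definition _ := Order.POrder_isTotal.Build ord_display Ord
  le_ord_total.

Implicit Types a b c d x y z : Ord.

Lemma le_piP t u : reflect (le_tree t u) (\pi_Ord t <= \pi_Ord u).
Proof. exact: le_ord_pi. Qed.

Lemma lt_piP z t :
  reflect (exists i : branch t, z <= \pi_Ord (subtree i)) (z < \pi_Ord t).
Proof.
rewrite -[z]reprK; set u := repr z; rewrite ltNge.
apply: (iffP negP) => [tu|[i ui] tu].
  have [/le_piP//|[i ui]] := le_tree_total t u.
  by exists i; apply/le_piP.
have /le_piP := le_trans tu ui.
elim: t i {tu ui} => A f IH i /le_treeE ti.
by have [j /IH] := ti i.
Qed.

Lemma ord_ind (P : Ord -> Prop) :
  (forall x, (forall y, y < x -> P y) -> P x) -> forall x, P x.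
Proof.
move=> step x; suff: forall t z, z <= \pi_Ord t -> P z.
  by move/(_ (repr x)); apply; rewrite reprK.
elim=> A f IH z zt; apply: step => y yz.
by have /lt_piP[i /IH] := lt_le_trans yz zt.
Qed.

Lemma ord_ext x y : (forall z, z < x <-> z < y) -> x = y.
Proof.
move=> xy; have [/xy|/xy|//] := ltgtP x y; by rewrite ltxx.
Qed.

Lemma ord_le_ext x y : (forall z, z < x -> z < y) -> x <= y.
Proof. by move=> xy; rewrite leNgt; apply/negP => /xy; rewrite ltxx. Qed.

(** The least upper bound of [F] (see [lub_leP]): the union of the [F i] as von
    Neumann ordinals. *)
Definition lub (I : Type) (F : I -> Ord) : Ord :=
  \pi_Ord (Sup (fun p : {i : I & branch (repr (F i))} => subtree (projT2 p))).

Lemma lt_lubP (I : Type) (F : I -> Ord) z :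
  reflect (exists i, z < F i) (z < lub F).
Proof.
apply: (iffP (lt_piP _ _)) => [[[i k] /= zk]|[i]].
  by exists i; rewrite -[F i]reprK; apply/lt_piP; exists k.
by rewrite -[F i]reprK => /lt_piP[k zk]; exists (existT _ i k).
Qed.

Lemma lub_leP (I : Type) (F : I -> Ord) x :
  lub F <= x <-> forall i, F i <= x.
Proof.
split=> [Fx i|Fx]; apply: ord_le_ext => z.
  by move=> zi; apply: lt_le_trans Fx; apply/lt_lubP; exists i.
by move=> /lt_lubP[i zi]; exact: lt_le_trans (Fx i).
Qed.

Definition zeroO : Ord := \pi_Ord (Sup (fun v : void => of_void tree v)).
Definition succO x : Ord := \pi_Ord (Sup (fun _ : unit => repr x)).
Definition finO (n : nat) : Ord := iter n succO zeroO.
Definition omegaO : Ord := lub finO.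

Lemma ltO0 z : (z < zeroO) = false.
Proof. by apply/negP => /lt_piP[i _]; case: i. Qed.

Lemma le0O z : zeroO <= z.
Proof. by rewrite leNgt ltO0. Qed.

Lemma ltOS z x : (z < succO x) = (z <= x).
Proof.
apply/lt_piP/idP => [[i]|zx]; first by rewrite /= reprK.
by exists tt; rewrite /= reprK.
Qed.

Lemma ltO_succ x : x < succO x.
Proof. by rewrite ltOS. Qed.

Lemma leSO x y : (succO x <= y) = (x < y).
Proof. by rewrite leNgt ltOS -ltNge. Qed.

Lemma leSSO x y : x <= y -> succO x <= succO y.
Proof. by rewrite leSO ltOS. Qed.

Lemma lt_omegaP z : reflect (exists n, z = finO n) (z < omegaO).
Proof.
apply: (iffP (lt_lubP _ _)) => [[n]|[n ->]]; last first.
  by exists n.+1; exact: ltO_succ.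
elim: n => [|n IH]; first by rewrite ltO0.
by rewrite ltOS le_eqVlt => /orP[/eqP->|//]; exists n.
Qed.

Definition is_limit x : Prop := zeroO < x /\ forall y, y < x -> succO y < x.

(** For monotone [F],
    [transrec a F b = max a (sup_{c < b} F (transrec a F c))]. *)
Fixpoint tree_rec_ord (a : Ord) (F : Ord -> Ord) (t : tree) : Ord :=
  let: Sup A f := t in
  Order.max a (lub (fun i => F (tree_rec_ord a F (f i)))).

Definition transrec (a : Ord) (F : Ord -> Ord) (b : Ord) : Ord :=
  tree_rec_ord a F (repr b).

Section Transrec.
Variables (a : Ord) (F : Ord -> Ord).
Hypothesis F_mono : {homo F : x y / x <= y}.

Lemma lt_tree_rec z t : z < tree_rec_ord a F t <->
  z < a \/ exists i : branch t, z < F (tree_rec_ord a F (subtree i)).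
Proof.
case: t => A f /=; rewrite lt_max.
split=> [/orP[|/lt_lubP]|[->//|zi]]; [by left|by right|].
by apply/orP; right; apply/lt_lubP.
Qed.

Lemma le_tree_rec t u :
  le_tree t u -> tree_rec_ord a F t <= tree_rec_ord a F u.
Proof.
elim: t u => A f IH u /le_treeE tu; apply: ord_le_ext => z.
move=> /lt_tree_rec[za|[i zi]]; apply/lt_tree_rec; [by left|right].
by have [j /IH/F_mono ij] := tu i; exists j; exact: lt_le_trans ij.
Qed.

Lemma transrec_pi t : transrec a F (\pi_Ord t) = tree_rec_ord a F t.
Proof.
by apply/eqP; rewrite eq_le !le_tree_rec//; apply/le_piP; rewrite reprK.
Qed.

Lemma lt_transrec z b : z < transrec a F b <->
  z < a \/ exists2 c, c < b & z < F (transrec a F c).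
Proof.
rewrite -[b]reprK transrec_pi lt_tree_rec.
split=> -[|]; [by left| |by left|].
  move=> [i zi]; right; exists (\pi_Ord (subtree i)); last by rewrite transrec_pi.
  by apply/lt_piP; exists i.
move=> [c /lt_piP[i ci] zc]; right; exists i; apply: lt_le_trans zc _.
apply: F_mono; rewrite -[c]reprK transrec_pi le_tree_rec//.
by apply/le_piP; rewrite reprK.
Qed.

Lemma transrec_mono : {homo transrec a F : b c / b <= c}.
Proof.
move=> b c bc; apply: ord_le_ext => z /lt_transrec[za|[d db zd]].
  by apply/lt_transrec; left.
by apply/lt_transrec; right; exists d => //; exact: lt_le_trans bc.
Qed.

Lemma transrec0 : transrec a F zeroO = a.
Proof.
apply: ord_ext => z; rewrite lt_transrec; split=> [[//|[c]]|]; last by left.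
by rewrite ltO0.
Qed.

Lemma transrecS b : (forall x, a <= x -> x <= F x) ->
  transrec a F (succO b) = F (transrec a F b).
Proof.
move=> infl; have aT c : a <= transrec a F c.
  by apply: ord_le_ext => z za; apply/lt_transrec; left.
apply: ord_ext => z; rewrite lt_transrec; split=> [[za|[c]]|zb].
- by apply: lt_le_trans za _; apply: le_trans (infl _ _).
- by rewrite ltOS => /transrec_mono/F_mono cb zc; exact: lt_le_trans cb.
- by right; exists b => //; exact: ltO_succ.
Qed.

Lemma transrec_lim b : is_limit b -> forall z,
  z < transrec a F b <-> exists2 c, c < b & z < transrec a F c.
Proof.
move=> [b0 bS] z; split=> [/lt_transrec[za|[c cb zc]]|[c /ltW/transrec_mono cb]].
- by exists zeroO => //; rewrite transrec0.
- exists (succO c); first exact: bS.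
  by apply/lt_transrec; right; exists c => //; exact: ltO_succ.
- by move=> zc; exact: lt_le_trans cb.
Qed.

End Transrec.

(** [a + b = max a (sup_{c < b} (a + c + 1))],
    [a * b = sup_{c < b} (a * c + a)],
    [omega_pow b = max 1 (sup_{c < b} (omega_pow c * omegaO))]; the usual
    equations at zero, successors and limits are derived below. *)

Definition addO a b : Ord := transrec a succO b.

Declare Scope ord_scope.
Delimit Scope ord_scope with ord.
Bind Scope ord_scope with Ord.
Notation "a + b" := (addO a b) : ord_scope.
Local Open Scope ord_scope.

Lemma lt_addO z a b : z < a + b <-> z < a \/ exists2 c, c < b & z <= a + c.
Proof.
rewrite (lt_transrec _ leSSO); split=> -[|[c cb]]; [by left| |by left|].
  by rewrite ltOS; right; exists c.
by move=> zc; right; exists c => //; rewrite ltOS.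
Qed.

Lemma addO0 a : a + zeroO = a.
Proof. exact: transrec0 leSSO. Qed.

Lemma addOS a b : a + succO b = succO (a + b).
Proof. by apply: (transrecS leSSO) => x _; exact/ltW/ltO_succ. Qed.

Lemma addO_lim a b : is_limit b -> forall z,
  z < a + b <-> exists2 c, c < b & z < a + c.
Proof. exact: transrec_lim leSSO _. Qed.

Lemma leO_add2l a b c : b <= c -> a + b <= a + c.
Proof. exact: transrec_mono leSSO _ _. Qed.

Lemma ltO_add2l a b c : b < c -> a + b < a + c.
Proof. by move=> bc; apply/lt_addO; right; exists b. Qed.

Lemma ltO_add2lE a b c : (a + b < a + c) = (b < c).
Proof.
apply/idP/idP; last exact: ltO_add2l.
by apply: contraTT; rewrite -!leNgt; exact: leO_add2l.
Qed.

Lemma addO_inj a : injective (addO a).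
Proof. by move=> b c; case: (ltgtP b c) => // /(ltO_add2l a) + E; rewrite E ltxx. Qed.

Lemma leO_addr a b : a <= a + b.
Proof. by rewrite -{1}[a]addO0 leO_add2l// le0O. Qed.

Lemma leO_add2r c a b : a <= b -> a + c <= b + c.
Proof.
move=> ab; elim/ord_ind: c => c IH; apply: ord_le_ext => z /lt_addO[za|[d dc zd]].
  exact: lt_le_trans (lt_le_trans za ab) (leO_addr _ _).
by apply/lt_addO; right; exists d => //; exact: le_trans (IH _ dc).
Qed.

Lemma add0O a : zeroO + a = a.
Proof.
elim/ord_ind: a => a IH; apply: ord_ext => z; rewrite lt_addO ltO0.
split=> [[//|[c ca]]|za]; last by right; exists z => //; rewrite IH.
by rewrite IH// => /le_lt_trans; apply.
Qed.

Lemma leO_addl a b : b <= a + b.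
Proof. by rewrite -{1}[b]add0O leO_add2r// le0O. Qed.

Lemma addOA a b c : a + (b + c) = (a + b) + c.
Proof.
elim/ord_ind: c => c IH; apply: ord_ext => z.
rewrite (lt_addO _ a) (lt_addO _ (a + b)).
split=> [[za|[e /lt_addO[eb|[d dc ed]] ze]]|[zab|[d dc zd]]].
- by left; exact: lt_le_trans (leO_addr _ _).
- by left; exact: le_lt_trans (ltO_add2l _ eb).
- right; exists d => //; rewrite -IH//; apply: le_trans ze _; exact: leO_add2l.
- move/lt_addO: zab => [za|[d db zd]]; [by left|right; exists d => //].
  exact: lt_le_trans (leO_addr _ _).
- by right; exists (b + d); [exact: ltO_add2l|rewrite IH].
Qed.

Lemma leO_addP a b : reflect (exists c, a = b + c) (b <= a).
Proof.
apply: (iffP idP) => [ba|[c ->]]; last exact: leO_addr.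
have: a < b + succO a by rewrite addOS ltOS leO_addl.
move: (succO a) => c; elim/ord_ind: c => c IH.
move=> /lt_addO[|[d dc]]; first by rewrite ltNge ba.
by rewrite le_eqVlt => /orP[/eqP->|]; [exists d|exact: IH].
Qed.

(** Unique by [addO_inj]; only used when [b <= a], where such a [c] exists. *)
Definition subO a b : Ord := xget zeroO [set c | a = b + c]%classic.
Notation "a - b" := (subO a b) : ord_scope.

Lemma subOKC a b : b <= a -> b + (a - b) = a.
Proof. by move=> /leO_addP[c ac]; rewrite /subO; case: xgetP => // /(_ c). Qed.

Lemma addOKC a b : (b + a) - b = a.
Proof. by apply: (@addO_inj b); rewrite subOKC// leO_addr. Qed.

Definition mulO a b : Ord := transrec zeroO (fun x => x + a) b.
Notation "a * b" := (mulO a b) : ord_scope.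

Lemma mulO_step a : {homo (fun x => x + a) : x y / x <= y}.
Proof. by move=> x y; exact: leO_add2r. Qed.

Lemma mulO0 a : a * zeroO = zeroO.
Proof. exact: transrec0 (@mulO_step a). Qed.

Lemma mulOS a b : a * succO b = a * b + a.
Proof. by apply: (transrecS (@mulO_step a)) => x _; exact: leO_addr. Qed.

Lemma mulO_lim a b : is_limit b -> forall z,
  z < a * b <-> exists2 c, c < b & z < a * c.
Proof. exact: transrec_lim (@mulO_step a) _. Qed.

Lemma leO_mul2l a b c : b <= c -> a * b <= a * c.
Proof. exact: transrec_mono (@mulO_step a) _ _. Qed.

Lemma leO_mul2r c a b : a <= b -> a * c <= b * c.
Proof.
move=> ab; elim/ord_ind: c => c IH; apply: ord_le_ext => z.
move=> /(lt_transrec _ (@mulO_step a)); rewrite ltO0 => -[//|[d dc zd]].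
apply/(lt_transrec _ (@mulO_step b)); right; exists d => //.
apply: lt_le_trans zd _; apply: le_trans (leO_add2l _ ab).
by apply: leO_add2r; exact: IH.
Qed.

Lemma mulO_fin1 a : a * finO 1 = a.
Proof. by rewrite mulOS mulO0 add0O. Qed.

Lemma mulO_finD a m n : a * finO (m + n)%N = a * finO m + a * finO n.
Proof.
elim: n => [|n IH]; first by rewrite addn0 /= mulO0 addO0.
by rewrite addnS /= !mulOS IH addOA.
Qed.

Lemma omega_limit : is_limit omegaO.
Proof.
split=> [|y]; first by apply/lt_omegaP; exists 0%N.
by move=> /lt_omegaP[n ->]; apply/lt_omegaP; exists n.+1.
Qed.

Lemma lt_mulO_omega z a : z < a * omegaO <-> exists n, z < a * finO n.
Proof.
rewrite (mulO_lim _ omega_limit); split=> [[c /lt_omegaP[n ->]]|[n zn]].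
  by exists n.
by exists (finO n) => //; apply/lt_omegaP; exists n.
Qed.

Lemma le_mulO_omega a : a <= a * omegaO.
Proof.
rewrite -{1}[a]mulO_fin1; apply/leO_mul2l/ltW/lt_omegaP; by exists 1%N.
Qed.

Lemma addO_lt_mul_omega a x y :
  x < a * omegaO -> y < a * omegaO -> x + y < a * omegaO.
Proof.
move=> /lt_mulO_omega[m xm] /lt_mulO_omega[n yn]; apply/lt_mulO_omega.
exists (m + n)%N; rewrite mulO_finD.
exact: lt_le_trans (ltO_add2l _ yn) (leO_add2r _ (ltW xm)).
Qed.

Definition omega_pow b : Ord := transrec (finO 1) (fun x => x * omegaO) b.

Lemma omega_pow_step : {homo (fun x => x * omegaO) : x y / x <= y}.
Proof. by move=> x y; exact: leO_mul2r. Qed.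

Lemma omega_pow0 : omega_pow zeroO = finO 1.
Proof. exact: transrec0 omega_pow_step. Qed.

Lemma omega_powS b : omega_pow (succO b) = omega_pow b * omegaO.
Proof. by apply: (transrecS omega_pow_step) => x _; exact: le_mulO_omega. Qed.

Lemma omega_pow_lim b : is_limit b -> forall z,
  z < omega_pow b <-> exists2 c, c < b & z < omega_pow c.
Proof. exact: transrec_lim omega_pow_step _. Qed.

Lemma le_omega_pow b c : b <= c -> omega_pow b <= omega_pow c.
Proof. exact: transrec_mono omega_pow_step _ _. Qed.

Lemma omega_pow_gt0 b : zeroO < omega_pow b.
Proof.
apply: lt_le_trans (le_omega_pow (le0O b)).
by rewrite omega_pow0; exact: ltO_succ.
Qed.

Lemma addO_lt_omega_pow b x y :
  x < omega_pow b -> y < omega_pow b -> x + y < omega_pow b.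
Proof.
move=> xb yb; move/(lt_transrec _ omega_pow_step): (xb).
rewrite ltOS le_eqVlt ltO0 orbF => -[/eqP->|[c cb xc]]; first by rewrite add0O.
move/(lt_transrec _ omega_pow_step): (yb).
rewrite ltOS le_eqVlt ltO0 orbF => -[/eqP->|[d db yd]]; first by rewrite addO0.
apply/(lt_transrec _ omega_pow_step); right; exists (Order.max c d).
  by rewrite gt_max cb.
apply: addO_lt_mul_omega.
  apply: lt_le_trans xc _; apply: omega_pow_step.
  by apply: le_omega_pow; rewrite le_max lexx.
apply: lt_le_trans yd _; apply: omega_pow_step.
by apply: le_omega_pow; rewrite le_max lexx orbT.
Qed.

Definition pair_mul (p q : Ord * Ord) : Ord * Ord :=
  let: (a, b) := p in let: (c, d) := q in
  if b <= c then (a + (c - b), d) else (a, d + (b - c)).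

Lemma pair_mul_l a b u d : pair_mul (a, b) (b + u, d) = (a + u, d).
Proof. by rewrite /pair_mul leO_addr addOKC. Qed.

Lemma pair_mul_r a c u d : pair_mul (a, c + u) (c, d) = (a, d + u).
Proof.
rewrite /pair_mul addOKC; case: ifPn => //.
rewrite -{2}[c]addO0 leNgt ltO_add2lE -leNgt => u0.
have -> : u = zeroO by apply/eqP; rewrite eq_le u0 le0O.
by rewrite !addO0 -{1}[c]addO0 addOKC addO0.
Qed.

Lemma pair_mulA : associative pair_mul.
Proof.
move=> [a b] [c d] [e f].
case: (leP b c) => [/leO_addP[u ->]|/ltW/leO_addP[u ->]].
  rewrite pair_mul_l; case: (leP d e) => [/leO_addP[v ->]|/ltW/leO_addP[v ->]].
    by rewrite !pair_mul_l -addOA pair_mul_l addOA.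
  by rewrite !pair_mul_r pair_mul_l.
rewrite pair_mul_r; case: (leP d e) => [/leO_addP[v ->]|/ltW/leO_addP[v ->]].
  rewrite pair_mul_l.
  by case: (leP u v) => [/leO_addP[w ->]|/ltW/leO_addP[w ->]];
    rewrite !addOA !(pair_mul_l, pair_mul_r).
by rewrite pair_mul_r -addOA !pair_mul_r addOA.
Qed.

Lemma pair_mul1p : left_id (zeroO, zeroO) pair_mul.
Proof. by move=> [c d]; rewrite -{1}[c]add0O pair_mul_l add0O. Qed.

Lemma pair_mulp1 : right_id (zeroO, zeroO) pair_mul.
Proof. by move=> [a b]; rewrite -{1}[b]add0O pair_mul_r add0O. Qed.

Record bicyclic (alpha : Ord) := Bicyclic {
  bval : Ord * Ord;
  bvalP : (bval.1 < omega_pow alpha) && (bval.2 < omega_pow alpha) }.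

HB.instance Definition _ alpha := [isSub for @bval alpha].
HB.instance Definition _ alpha := [Choice of bicyclic alpha by <:].

Section BicyclicMonoid.
Variable alpha : Ord.

Lemma bicyclic_mul_subproof (p q : bicyclic alpha) :
  let r := pair_mul (bval p) (bval q) in
  (r.1 < omega_pow alpha) && (r.2 < omega_pow alpha).
Proof.
have sub_lt b c : c < omega_pow alpha -> b <= c -> c - b < omega_pow alpha.
  by move=> cl bc; apply: le_lt_trans cl; rewrite -{2}(subOKC bc) leO_addl.
case: p q => [[a b] /= /andP[al bl]] [[c d] /= /andP[cl dl]].
case: (leP b c) => bc /=; first by rewrite dl andbT addO_lt_omega_pow// sub_lt.
by rewrite al addO_lt_omega_pow// sub_lt// ltW.
Qed.

Definition bicyclic_mul (p q : bicyclic alpha) : bicyclic alpha :=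
  Bicyclic (bicyclic_mul_subproof p q).

Lemma bicyclic_one_subproof :
  let r := (zeroO, zeroO) in
  (r.1 < omega_pow alpha) && (r.2 < omega_pow alpha).
Proof. by rewrite /= omega_pow_gt0. Qed.

Definition bicyclic_one : bicyclic alpha := Bicyclic bicyclic_one_subproof.

Lemma bicyclic_mulA : associative bicyclic_mul.
Proof. by move=> p q r; apply: val_inj; exact: pair_mulA. Qed.

Lemma bicyclic_mul1p : left_id bicyclic_one bicyclic_mul.
Proof. by move=> p; apply: val_inj; exact: pair_mul1p. Qed.

Lemma bicyclic_mulp1 : right_id bicyclic_one bicyclic_mul.
Proof. by move=> p; apply: val_inj; exact: pair_mulp1. Qed.

HB.instance Definition _ := isSemigroup.Build (bicyclic alpha) bicyclic_mulA.
HB.instance Definition _ := Semigroup_isMonoid.Build (bicyclic alpha)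
  bicyclic_mul1p bicyclic_mulp1.

End BicyclicMonoid.

Definition bruck (S : Type) : Type := (nat * S * nat)%type.

HB.instance Definition _ (S : choiceType) := Choice.on (bruck S).

Section Bruck.
Variable S : semigroupType.

(* the truncated [nat] subtractions only occur with a smaller subtrahend *)
Definition bruck_mul (p q : bruck S) : bruck S :=
  let: (a, s, b) := p in let: (c, t, d) := q in
  if (b < c)%N then ((a + c - b)%N, t, d)
  else if (c < b)%N then (a, s, (d + b - c)%N)
  else (a, (s * t)%g, d).

Lemma bruck_mulA : associative bruck_mul.
Proof.
move=> [[a s] b] [[c t] d] [[e u] f]; rewrite /bruck_mul.
by case: (ltngtP b c) => ?; case: (ltngtP d e) => ?; subst;
  repeat (case: ltngtP => ?; subst); rewrite ?mulgA; try (exfalso; lia);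
  do 2?congr pair; lia.
Qed.

HB.instance Definition _ := isSemigroup.Build (bruck S) bruck_mulA.

End Bruck.

Definition semigroup_isomorphic (S T : semigroupType) : Prop :=
  exists f : {multiplicative S -> T}, bijective f.

(* Main.v *)
(** Division by [omega ^ alpha] writes each ordinal below [omega ^ (alpha + 1)]
    uniquely as [omega ^ alpha * m + r] with [m] finite and
    [r < omega ^ alpha].  Splitting both coordinates of a pair in this way gives
    the isomorphism; it respects the products because such an [r] is absorbed:
    [r + omega ^ alpha = omega ^ alpha]. *)

Require Import Defs.
From HB Require Import structures.
From mathcomp Require Import all_boot all_order.
From mathcomp Require Import boolp.
From mathcomp Require Import zify.

Set Implicit Arguments.
Unset Strict Implicit.
Unset Printing Implicit Defensive.

Import Order.TTheory.

Local Open Scope order_scope.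
Local Open Scope ord_scope.

(** Ordinals below [omega_pow b] are closed under addition, so each [r + c] with [c < omega_pow b]
    stays below [omega_pow b], and the supremum cannot exceed it. *)
Lemma addO_omega_pow r b : r < omega_pow b -> r + omega_pow b = omega_pow b.
Proof.
move=> rb; apply/eqP; rewrite eq_le leO_addl andbT.
apply: ord_le_ext => z /lt_addO[zr|[c cb zc]]; first exact: lt_trans rb.
exact: le_lt_trans zc (addO_lt_omega_pow rb cb).
Qed.

(** The successor [k.+1] provides at least one copy of [omega_pow b] to the right of [r]; the
    leftmost copy swallows [r]. *)
Lemma addO_omega_pow_mul_absorb b r t m k : r < omega_pow b ->
  (omega_pow b * finO m + r) + (omega_pow b * finO k.+1 + t)
    = omega_pow b * finO (m + k.+1)%N + t.
Proof.
move=> rb; rewrite -add1n !mulO_finD mulO_fin1 -!addOA; congr (_ + _).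
by rewrite addOA addO_omega_pow.
Qed.

Lemma mulO_finDmodl_lt a m n r s : r < a -> (m < n)%N ->
  a * finO m + r < a * finO n + s.
Proof.
move=> ra mn; apply: lt_le_trans (ltO_add2l _ ra) _.
by rewrite -mulOS -[succO _]/(finO m.+1) -(subnKC mn) mulO_finD -addOA leO_addr.
Qed.

Lemma mulO_fin_div_uniq a m n r s : r < a -> s < a ->
  a * finO m + r = a * finO n + s -> m = n /\ r = s.
Proof.
move=> ra sa E; case: (ltngtP m n) => [mn|nm|mn].
- by have := mulO_finDmodl_lt s ra mn; rewrite E ltxx.
- by have := mulO_finDmodl_lt r sa nm; rewrite E ltxx.
- by move: E; rewrite mn => /addO_inj.
Qed.

(** Induction on a finite multiple of [a] above [z]: either [z] lies in the last block of length
    [a], or one block fewer suffices. *)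
Lemma mulO_omega_div a z : z < a * omegaO ->
  exists m, exists2 r, r < a & z = a * finO m + r.
Proof.
move=> /lt_mulO_omega[n]; elim: n => [|n IH]; first by rewrite mulO0 ltO0.
rewrite mulOS; have [/leO_addP[r ->]|/IH//] := leP (a * finO n) z.
by rewrite ltO_add2lE => ra; exists n, r.
Qed.

(** Comparison and left subtraction ignore a common left summand [y]. This settles the case of equal
    inner indices in the Bruck product. *)
Lemma pair_mul_add2 x y z r s t u :
  pair_mul (x + r, y + s) (y + t, z + u) =
    (x + (pair_mul (r, s) (t, u)).1, z + (pair_mul (r, s) (t, u)).2).
Proof.
case: (leP s t) => [/leO_addP[v ->]|/ltW/leO_addP[v ->]].
  by rewrite addOA !pair_mul_l /= addOA.
by rewrite addOA !pair_mul_r /= addOA.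
Qed.

Local Arguments pair_mul : simpl never.

Section BruckToBicyclic.
Variable alpha : Ord.

Lemma omega_pow_add1 : omega_pow (alpha + finO 1) = omega_pow alpha * omegaO.
Proof. by rewrite addOS addO0 omega_powS. Qed.

Lemma divmod_lt_omega_pow_add1 m r : r < omega_pow alpha ->
  omega_pow alpha * finO m + r < omega_pow (alpha + finO 1).
Proof.
move=> ra; rewrite omega_pow_add1; apply/lt_mulO_omega; exists m.+1.
by rewrite mulOS ltO_add2l.
Qed.

(** Starting from the Bruck side gives an explicit formula; the opposite direction would have to
    choose quotients and remainders. *)
Definition bruck_to_pair (x : bruck (bicyclic alpha)) : Ord * Ord :=
  let: (m, p, n) := x in
  (omega_pow alpha * finO m + (bval p).1, omega_pow alpha * finO n + (bval p).2).

Lemma bruck_to_pair_lt x :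
  ((bruck_to_pair x).1 < omega_pow (alpha + finO 1)) &&
  ((bruck_to_pair x).2 < omega_pow (alpha + finO 1)).
Proof.
by case: x => [[m [p /= /andP[? ?]]] n]; rewrite !divmod_lt_omega_pow_add1.
Qed.

Definition bruck_to_bicyclic x : bicyclic (alpha + finO 1) :=
  Bicyclic (bruck_to_pair_lt x).

Lemma bruck_to_pairM x y :
  bruck_to_pair (bruck_mul x y) = pair_mul (bruck_to_pair x) (bruck_to_pair y).
Proof.
case: x y => [[m p] n] [[k q] l].
case: p q => [[r s] /= rs] [[t u] /= tu].
have /andP[ra sa] := rs; have /andP[ta ua] := tu.
case: (ltngtP n k) => [nk|kn|->] /=; last by rewrite pair_mul_add2.
  (* Absorption read backwards inserts [s], so that the first coordinate of the right factor becomes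
     the second coordinate of the left one plus a remainder. Adding that remainder to the left
     factor's first coordinate then absorbs [r]. *)
  have -> : k = (n + (k - n).-1.+1)%N by lia.
  rewrite -(addO_omega_pow_mul_absorb t n _ sa) pair_mul_l.
  by rewrite addO_omega_pow_mul_absorb//; do 4!f_equal; lia.
have -> : n = (k + (n - k).-1.+1)%N by lia.
rewrite -(addO_omega_pow_mul_absorb s k _ ta) pair_mul_r.
by rewrite addO_omega_pow_mul_absorb//; do 4!f_equal; lia.
Qed.

Lemma bruck_to_bicyclicM x y :
  bruck_to_bicyclic (x * y)%g = (bruck_to_bicyclic x * bruck_to_bicyclic y)%g.
Proof. by apply: val_inj; exact: bruck_to_pairM. Qed.

Lemma bruck_to_bicyclic_inj : injective bruck_to_bicyclic.
Proof.
move=> [[m p] n] [[k q] l] /(congr1 (@bval _)).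
case: p q => [[r s] /= rs] [[t u] /= tu] [].
have /andP[ra sa] := rs; have /andP[ta ua] := tu.
move=> /(mulO_fin_div_uniq ra ta)[-> rt] /(mulO_fin_div_uniq sa ua)[-> su].
by do 2!congr pair; apply: val_inj; rewrite /= rt su.
Qed.

Lemma bruck_to_bicyclic_surj z : exists x, bruck_to_bicyclic x = z.
Proof.
case: z => [[a b] /= ab]; have /andP[] := ab; rewrite omega_pow_add1.
move=> /mulO_omega_div[m [r ra am]] /mulO_omega_div[n [s sa bn]].
have rs : ((r, s).1 < omega_pow alpha) && ((r, s).2 < omega_pow alpha).
  by rewrite /= ra sa.
by exists (m, Bicyclic rs, n); apply: val_inj; rewrite /= am bn.
Qed.

End BruckToBicyclic.

Theorem theorem1 (alpha : Ord) :
  semigroup_isomorphic (bicyclic (alpha + finO 1)) (bruck (bicyclic alpha)).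
Proof.
(* A choice of preimages is a right inverse; injectivity makes it two-sided, and the inverse of a
   multiplicative bijection is multiplicative. *)
have [f gK] := choice (@bruck_to_bicyclic_surj alpha).
have fK : cancel (@bruck_to_bicyclic alpha) f.
  by move=> x; apply: bruck_to_bicyclic_inj; rewrite gK.
have fM : {morph f : x y / (x * y)%g}.
  by move=> x y; rewrite -{1}[x]gK -{1}[y]gK -bruck_to_bicyclicM fK.
pose fmul := isMultiplicative.Build _ _ f fM.
pose F : {multiplicative bicyclic (alpha + finO 1) -> bruck (bicyclic alpha)} :=
  HB.pack f fmul.
by exists F; exists (@bruck_to_bicyclic alpha).
Qed.
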